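(* Let $G$ be a finite group and $\alpha$ an automorphism of $G$. For any subgroup $H$ of $G$ with $H\subseteq T_{3,\alpha}$ and any $x\in T_{3,\alpha}$, the subset $\mathscr{T}(H,x)$ of the abelian group $H/C_H(x)$, written additively, contains no non-trivial solutions to either of the equations $a+b=2c$, $a+2b=3c$. In particular, it contains no 3-term arithmetic progressions.
   Context: For a finite group $G$ and an automorphism $\alpha$ of $G$ (written on the right), put $T_{3,\alpha}=\{g\in G : g\alpha = g^3\}$. A subgroup $H\subseteq T_{3,\alpha}$ is necessarily abelian. $C_H(x)$ is the centralizer of $x$ in $H$. For $x\in T_{3,\alpha}$ the set $\{h\in H : hx\in T_{3,\alpha}\}$ is a union of cosets of $C_H(x)$ in $H$, and $\mathscr{T}(H,x)$ denotes the corresponding subset of $H/C_H(x)$, i.e. $\mathscr{T}(H,x)=\{hC_H(x) : h\in H,\ hx\in T_{3,\alpha}\}$. A solution $(a,b,c)$ of one of the equations, with $a,b,c\in \mathscr{T}(H,x)$, is non-trivial if $a,b,c$ are not all equal. A 3-term arithmetic progression is a solution to $a+b=2c$ with $a\neq b$. *)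

(* Defs.v *)
From HB Require Import structures.
From mathcomp Require Import all_boot all_order all_algebra all_fingroup.

Set Implicit Arguments.
Unset Strict Implicit.
Unset Printing Implicit Defensive.

Local Open Scope group_scope.

Definition T3 (gT : finGroupType) (G : {group gT}) (alpha : {perm gT}) :
    {set gT} :=
  [set g in G | alpha g == g ^+ 3].

(* A subgroup H contained in T3 G alpha is abelian, so every h in H normalises *)
(* 'C_H[x] and the element [coset 'C_H[x] h] is the genuine coset h C_H(x).    *)
Definition Tset (gT : finGroupType) (G : {group gT}) (alpha : {perm gT})
    (H : {group gT}) (x : gT) : {set coset_of 'C_H[x]} :=
  [set coset 'C_H[x] h | h in H & h * x \in T3 G alpha].

Definition nontrivial_triple (T : Type) (a b c : T) : Prop :=
  ~ (a = b /\ b = c).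

(* Main.v *)
Require Import Defs.
From HB Require Import structures.
From mathcomp Require Import all_boot all_order all_algebra all_fingroup.

Local Open Scope group_scope.

(** Write T for [T3 G alpha] and, for fixed [y] in T, let [w_i] be the conjugate
    [y ^+ i * w * y ^- i].  When [w], [y] and [w * y] all lie in T, cancelling
    in [(w * y) ^+ 3 = w ^+ 3 * y ^+ 3] leaves the recurrence
    [w_0 ^+ 2 = w_1 * w_2], hence [w_i ^+ 2 = w_(i+1) * w_(i+2)] for all i.

    Commutation of [w_0] and [w_1] already forces [w] to centralise [y].  The
    recurrence then says that conjugation by [y] acts on the defect
    [v = w_1 * w_0^-1] as [v |-> v ^- 2]; comparing this with the action of
    [alpha], which sends [v] to [v ^+ 9], gives [v ^+ 54 = 1].  Injectivity of
    [alpha] removes the factor 27, and then [v ^+ 2 = 1] says that a conjugate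
    of [v] is trivial ([commute_conj_T3]).

    It remains to make [w_0] and [w_1] commute, and this is where a second
    translate is used.  If [w^-1 * y] is in T, inverting its recurrence gives
    [w_0 ^+ 2 = w_2 * w_1], so [w_1] and [w_2] commute
    ([commute_translates_inv]).  If [w ^+ 3 * y] is in
    T, then [w_0 ^+ 6 = w_1 ^+ 3 * w_2 ^+ 3] as well, and a computation with
    words turns this into [w_0 ^+ 2 * w_1 = w_3 ^+ 2 * w_4]: the element
    [w_0 ^+ 2 * w_1] is centralised by [y ^+ 3], hence by [y], since [alpha]
    makes the order of [y] prime to 3.  Thus [w_0 ^+ 2 * w_1] equals
    [w_1 ^+ 2 * w_2 = w_1 * w_0 ^+ 2], so [w_1] commutes with
    [w_0 ^+ 2 = w_1 * w_2], and therefore with [w_2]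
    ([commute_translates_cube]).

    Finally, lift [a], [b], [c] to elements h_a, h_b, h_c of [H].  For
    [a * b = c ^+ 2], take [y = h_c * x] and [w = h_b * h_c^-1]; then
    [w^-1 * y] is h_a * x up to a factor in [C_H(x)].  For
    [a * b ^+ 2 = c ^+ 3], take [y = h_b * x] and [w = h_c * h_b^-1]; then
    [w ^+ 3 * y] is h_a * x up to such a factor.  In both cases [w]
    centralises [y], hence [x], so [b = c], and the equation gives [a = c]. *)

Section Words.

Set Implicit Arguments.
Unset Strict Implicit.

Variable gT : finGroupType.
Implicit Types a b c d e g h w y : gT.

(** The middle letters of [(g * h) ^+ 3 = g ^+ 3 * h ^+ 3], after cancelling
    [g] on the left and [h] on the right. *)
Lemma cube_mul_cancel g h :
  (g * h) ^+ 3 = g ^+ 3 * h ^+ 3 -> h * g * h * g = g * g * h * h.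
Proof.
rewrite !expgS !expg0 !mulg1 => E.
by apply: (mulgI g); apply: (mulIg h); rewrite !mulgA in E *.
Qed.

Lemma conjg3 g h : g ^ (h ^+ 3) = ((g ^ h) ^ h) ^ h.
Proof. by rewrite !expgS expg0 mulg1 !conjgM. Qed.

Lemma recurrence_of_cube w y : (w * y) ^+ 3 = w ^+ 3 * y ^+ 3 ->
  w ^+ 2 = w ^ y^-1 * (w ^ y^-1) ^ y^-1.
Proof.
move/cube_mul_cancel => E; rewrite !conjgE !invgK !mulgA mulgKV.
by apply: (mulIg y); apply: (mulIg y); rewrite !mulgKV E expg2.
Qed.

(** With [a, b, c, d, e] consecutive terms of a sequence obeying the recurrence,
    the cube identity shifts [a ^+ 2 * b] by three places: [b * c * b], which
    is [a ^+ 2 * b], also equals [d * c ^+ 2 = d ^+ 2 * e]. *)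
Lemma recurrence_shift3 a b c d e :
    a ^+ 2 = b * c -> b ^+ 2 = c * d -> c ^+ 2 = d * e ->
    (b * c) ^+ 3 = b ^+ 3 * c ^+ 3 ->
  a ^+ 2 * b = d ^+ 2 * e.
Proof.
move=> Ea Eb Ec Ebc.
have E : b * (c * b) = d * (d * e).
  apply: (mulgI c); rewrite !mulgA (cube_mul_cancel Ebc) -(expg2 b) Eb.
  by rewrite -(mulgA (c * d)) -(expg2 c) Ec !mulgA.
by rewrite Ea -(mulgA b) E mulgA expg2.
Qed.

(** One step of the linear recurrence on commuting terms, whose characteristic
    polynomial is (t - 1)(t + 2): the defect is an eigenvector for -2. *)
Lemma defect_conj w p : commute w (w ^ p) -> w ^+ 2 = w ^ p * (w ^ p) ^ p ->
  (w ^ p * w^-1) ^ p = (w ^ p * w^-1) ^- 2.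
Proof.
move=> cw E.
rewrite conjMg conjVg.
have -> : (w ^ p) ^ p = (w ^ p)^-1 * w ^+ 2 by rewrite E mulKg.
have cwV : commute w (w ^ p)^-1 := commuteV cw.
rewrite -[RHS]expgVn (invMg (w ^ p)) invgK [RHS]expgMn //.
by rewrite (commuteX 2 (commute_sym cwV)) expg2 mulgA.
Qed.

End Words.

Section CubingAutomorphism.

Set Implicit Arguments.
Unset Strict Implicit.

Variables (gT : finGroupType) (G : {group gT}) (alpha : {perm gT}).
Hypothesis alphaP : alpha \in Aut G.
Implicit Types g h w y : gT.

Local Notation T := (T3 G alpha).
Local Notation f := (autm alphaP).

Lemma T3P g : reflect (g \in G /\ f g = g ^+ 3) (g \in T).
Proof. by rewrite inE autmE; apply: (iffP andP) => -[-> /eqP]. Qed.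

Lemma autm_eq1 g : g \in G -> f g = 1 -> g = 1.
Proof. by move=> Gg fg; apply: (injmP (injm_autm alphaP)); rewrite ?morph1. Qed.

(** An automorphism acting on [<[g]>] as the [n]-th power map forces the order
    of [g] to be prime to [n]. *)
Lemma power_map_expg_eq1 n g : g \in G -> f g = g ^+ n ->
  forall m, g ^+ (m * n) = 1 -> g ^+ m = 1.
Proof.
move=> Gg fg m gmn; apply: autm_eq1; first exact: groupX.
by rewrite morphX //= fg -expgM mulnC.
Qed.

Lemma T3X n g : g \in T -> g ^+ n \in T.
Proof.
by case/T3P=> Gg fg; apply/T3P; rewrite groupX // morphX //= fg -!expgM mulnC.
Qed.

Lemma T3V g : g \in T -> g^-1 \in T.
Proof.
by case/T3P=> Gg fg; apply/T3P; rewrite groupV morphV //= fg expgVn.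
Qed.

Lemma T3_commM g h : commute g h -> g \in T -> h \in T -> g * h \in T.
Proof.
move=> cgh /T3P[Gg fg] /T3P[Gh fh]; apply/T3P.
by rewrite groupM // morphM //= fg fh expgMn.
Qed.

Lemma T3_mul_cube g h : g \in T -> h \in T -> g * h \in T ->
  (g * h) ^+ 3 = g ^+ 3 * h ^+ 3.
Proof. by move=> /T3P[Gg <-] /T3P[Gh <-] /T3P[_ <-]; rewrite morphM. Qed.

(** The order of [h] is prime to 3 because [h] and [h ^+ 3 = alpha h] have the
    same order; so [h] is a power of [h ^+ 3]. *)
Lemma T3_commute_cube g h : h \in T -> commute g (h ^+ 3) -> commute g h.
Proof.
case/T3P=> Gh fh cgh3; have eqh : <[h ^+ 3]> = <[h]>.
  apply/eqP; rewrite eqEcard cycleX -!orderE -fh.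
  by rewrite (order_injm (injm_autm alphaP)) //= leqnn.
by apply/cent1P; rewrite -cent_cycle -eqh cent_cycle; apply/cent1P.
Qed.

(** The classical fact that an injective cubing endomorphism forces
    commutativity, for a pair: shifting brackets in [h * (g * h) ^+ 3] shows
    that [h ^+ 2] commutes with [g ^+ 3], hence with [g], and then
    [h * g * h * g = g ^+ 2 * h ^+ 2] collapses. *)
Lemma T3_commute g h :
  g \in T -> h \in T -> g * h \in T -> h * g \in T -> commute g h.
Proof.
move=> Tg Th Tgh Thg.
have Egh := T3_mul_cube Tg Th Tgh; have Ehg := T3_mul_cube Th Tg Thg.
have c32 : commute (h ^+ 2) (g ^+ 3).
  apply: (mulgI h); apply: (mulIg h); rewrite /commute.
  have: h * (g * h) ^+ 3 = (h * g) ^+ 3 * h.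
    by rewrite !expgS !expg0 !mulg1 !mulgA.
  by rewrite Egh Ehg !expgS !expg0 !mulg1 !mulgA => ->.
have c2 := T3_commute_cube Tg c32.
apply: (mulgI h); apply: (mulIg g).
rewrite mulgA (cube_mul_cancel Egh) -mulgA -(expg2 h) -mulgA -!c2.
by rewrite mulgA -c2 expg2 !mulgA.
Qed.

Lemma recurrence_of_T3 w y : w \in T -> y \in T -> w * y \in T ->
  w ^+ 2 = w ^ y^-1 * (w ^ y^-1) ^ y^-1.
Proof. by move=> Tw Ty Twy; apply: recurrence_of_cube; apply: T3_mul_cube. Qed.

(** With [v] the defect of [w], the iterated conjugates of [w] are [v * w],
    [v^-1 * w] and [v ^+ 3 * w]; as [alpha] turns conjugation by [p = y^-1] into
    conjugation by [p ^+ 3], the third one determines [alpha v]. *)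
Lemma commute_conj_T3 w y : w \in T -> y \in T -> w * y \in T ->
  commute w (w ^ y^-1) -> commute w y.
Proof.
move=> Tw Ty Twy cw; have Ew := recurrence_of_T3 Tw Ty Twy.
have vp := defect_conj cw Ew.
suffices: w ^ y^-1 = w.
  by move/conjg_fixP/commgP/commuteV; rewrite invgK.
have /T3P[Gw fw] := Tw; have /T3P[Gy fy] := Ty.
set p := y^-1 in cw Ew vp *.
have Gp : p \in G by rewrite groupV.
have Gwp : w ^ p \in G by rewrite groupJ.
have fp : f p = p ^+ 3 by rewrite morphV //= fy expgVn.
have ew : w ^ p = w ^ p * w^-1 * w by rewrite mulgKV.
clearbody p.
set v := w ^ p * w^-1 in vp ew.
have Gv : v \in G by rewrite groupM ?groupV.
have cv : commute v w.
  by apply: commute_sym; apply: commuteM => //; apply: commuteV.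
have vpk n : (v ^+ n) ^ p = v ^- (2 * n).
  by rewrite conjXg vp expgVn -expgM.
have wp3 : w ^ (p ^+ 3) = v ^+ 3 * w.
  have wpp : (w ^ p) ^ p = v^-1 * w.
    by rewrite ew conjMg vp ew mulgA expg2 invMg mulgKV.
  by rewrite conjg3 wpp conjMg conjVg vp invgK ew mulgA -expgSr.
have fv : f v = v ^+ 9.
  rewrite morphM ?groupV // morphV //= morphJ //= fw fp conjXg wp3.
  by rewrite expgMn ?mulgK -?expgM //; apply/commute_sym/commuteX/commute_sym.
(* Apply alpha to v ^ p = v ^- 2: the left side becomes (v ^+ 9) ^ (p ^+ 3),
   which is v ^- 72, and the right side v ^- 18. *)
have v54 : v ^+ (6 * 9) = 1.
  have : f (v ^ p) = f (v ^- 2) by rewrite vp.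
  rewrite morphJ //= morphV ?groupX //= morphX //= fv fp conjg3 -expgM.
  rewrite !(vpk, conjVg, invgK) => /invg_inj.
  by rewrite (expgD v 54 18) -[RHS]mul1g => /mulIg.
have v6 := power_map_expg_eq1 Gv fv v54.
have v2 : v ^+ 2 = 1.
  by apply: (power_map_expg_eq1 Gv fv); rewrite (expgM v 6 3) v6 expg1n.
have v1 : v = 1.
  by apply: (conjg_inj p); rewrite vp v2 invg1 conj1g.
by rewrite ew v1 mul1g.
Qed.

Lemma T3_group_abelian (H : {group gT}) : H \subset T -> abelian H.
Proof.
move/subsetP=> sHT; apply/centsP=> g Hg h Hh.
by apply: T3_commute; apply: sHT => //; apply: groupM.
Qed.

(** Inverting the recurrence of [w^-1] reverses its right-hand side, so [w_1]
    and [w_2] commute. *)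
Lemma commute_translates_inv w y : w \in T -> y \in T ->
  w * y \in T -> w^-1 * y \in T -> commute w y.
Proof.
move=> Tw Ty Twy TVwy.
have E := recurrence_of_T3 Tw Ty Twy.
have EV := recurrence_of_T3 (T3V Tw) Ty TVwy.
apply: commute_conj_T3 => //; apply: (conjg_inj y^-1); rewrite conjMg -E conjMg.
apply: invg_inj; rewrite -expgVn EV !conjVg.
by rewrite [RHS]invMg.
Qed.

(** The recurrences of [w] and of [w ^+ 3] together show that conjugation by
    [y ^+ 3] fixes [w_0 ^+ 2 * w_1]; since 3 is prime to the order of [y], so
    does conjugation by [y], and this fixed point makes [w_1] and [w_2]
    commute. *)
Lemma commute_translates_cube w y : w \in T -> y \in T ->
  w * y \in T -> w ^+ 3 * y \in T -> commute w y.
Proof.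
move=> Tw Ty Twy Tw3y.
have E := recurrence_of_T3 Tw Ty Twy.
have E3 := recurrence_of_T3 (T3X 3 Tw) Ty Tw3y.
set p := y^-1 in E E3.
pose w1 := w ^ p; pose w2 := w1 ^ p; pose w3 := w2 ^ p; pose w4 := w3 ^ p.
have E1 : w1 ^+ 2 = w2 * w3 by rewrite -conjXg E conjMg.
have E2 : w2 ^+ 2 = w3 * w4 by rewrite -conjXg E1 conjMg.
have E6 : (w1 * w2) ^+ 3 = w1 ^+ 3 * w2 ^+ 3.
  by rewrite -!conjXg -E3 -E -!expgM.
have shift := recurrence_shift3 E E1 E2 E6.
have fixp : (w ^+ 2 * w1) ^ p = w ^+ 2 * w1.
  have : commute (w ^+ 2 * w1) y.
    apply: (T3_commute_cube Ty).
    suffices: commute (w ^+ 2 * w1) (p ^+ 3).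
      by move/commuteV; rewrite -expgVn invgK.
    apply/commgP/conjg_fixP; rewrite [RHS]shift.
    have step a b : (a ^+ 2 * b) ^ p = (a ^ p) ^+ 2 * b ^ p.
      by rewrite conjMg conjXg.
    by rewrite conjg3 !step.
  by move/commuteV/commgP/conjg_fixP.
have c1 : commute w1 w2.
  apply: (mulgI w1); have: w1 ^+ 2 * w2 = w ^+ 2 * w1.
    by rewrite -fixp conjMg conjXg.
  by rewrite E expg2 !mulgA.
apply: commute_conj_T3 => //; apply: (conjg_inj p).
by rewrite conjMg [RHS]conjMg; exact: c1.
Qed.

End CubingAutomorphism.

(* The abelian quotient H / 'C_H[x] is written multiplicatively: a + 2b = 3c   *)
(* reads a * b ^+ 2 = c ^+ 3.                                                  *)
Theorem proposition2p9 (gT : finGroupType) (G : {group gT}) (alpha : {perm gT})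
    (alphaP : alpha \in Aut G) (H : {group gT}) (sHG : H \subset G)
    (sHT : H \subset T3 G alpha) (x : gT) (xT : x \in T3 G alpha) :
  [/\ ~ (exists a b c : coset_of 'C_H[x],
           [/\ a \in Tset G alpha H x, b \in Tset G alpha H x,
               c \in Tset G alpha H x, a * b = c ^+ 2
             & nontrivial_triple a b c]),
      ~ (exists a b c : coset_of 'C_H[x],
           [/\ a \in Tset G alpha H x, b \in Tset G alpha H x,
               c \in Tset G alpha H x, a * b ^+ 2 = c ^+ 3
             & nontrivial_triple a b c])
    & ~ (exists a b c : coset_of 'C_H[x],
           [/\ a \in Tset G alpha H x, b \in Tset G alpha H x,
               c \in Tset G alpha H x, a * b = c ^+ 2 & a <> b])].
Proof.
have abH : abelian H := T3_group_abelian alphaP sHT.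
have nCH h : h \in H -> h \in 'N('C_H[x]).
  by apply/subsetP/(sub_abelian_norm abH)/subsetIl.
have cH h k : h \in H -> k \in H -> commute h k.
  by move=> *; apply: (centsP abH).
(* Membership in Tset does not depend on the representative: if z in C_H(x) and
   k * x is in T3, then z and k * x commute, so their product is in T3. *)
have TsetP h : h \in H -> coset 'C_H[x] h \in Tset G alpha H x ->
    h * x \in T3 G alpha.
  move=> Hh /imsetP[k /setIdP[Hk Tkx]].
  move/(rcoset_kercosetP (nCH _ Hh) (nCH _ Hk))/rcosetP=> [z /setIP[Hz cz] ->].
  rewrite -mulgA; apply: (T3_commM alphaP) => //; last exact: (subsetP sHT).
  by apply: commuteM; [apply: cH | apply/cent1P].
have liftP a : a \in Tset G alpha H x ->
    exists h, [/\ h \in H, a = coset 'C_H[x] h & h * x \in T3 G alpha].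
  by case/imsetP=> h /setIdP[Hh Thx] ->; exists h.
have coset_eq h k : h \in H -> k \in H -> commute (h * k^-1) (k * x) ->
    coset 'C_H[x] h = coset 'C_H[x] k.
  move=> Hh Hk cx; have Hhk : h * k^-1 \in H by rewrite groupM ?groupV.
  apply/(rcoset_kercosetP (nCH _ Hh) (nCH _ Hk)); rewrite mem_rcoset inE Hhk.
  rewrite -(mulKg k x); apply/cent1P/commuteM => //.
  by apply/commuteV/cH.
have progression_trivial a b c :
    a \in Tset G alpha H x -> b \in Tset G alpha H x ->
    c \in Tset G alpha H x -> a * b = c ^+ 2 -> a = c /\ b = c.
  move=> Ta /liftP[h [Hh Eb Th]] /liftP[k [Hk Ec Tk]] E.
  have Ea : a = coset 'C_H[x] ((h * k^-1)^-1 * k).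
    (* In H this is the representative k ^+ 2 * h^-1 of c ^+ 2 * b^-1. *)
    apply: (mulIg (coset 'C_H[x] h)); rewrite -{1}Eb E Ec -morphX ?nCH //.
    rewrite -morphM ?nCH ?groupM ?groupV ?groupM ?groupV //=.
    congr (coset 'C_H[x] _).
    by rewrite invMg invgK -mulgA (cH k h) // mulgA mulgKV expg2.
  have Twk : (h * k^-1)^-1 * (k * x) \in T3 G alpha.
    rewrite mulgA; apply: TsetP; last by rewrite -Ea.
    by rewrite groupM ?groupV ?groupM ?groupV.
  have bc : b = c.
    rewrite Eb Ec; apply: coset_eq => //.
    apply: (commute_translates_inv alphaP) => //; last by rewrite mulgA mulgKV.
    by rewrite (subsetP sHT) ?groupM ?groupV.
  split=> //; apply: (mulIg c); rewrite -{1}bc E; exact: expg2.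
have weighted_trivial a b c :
    a \in Tset G alpha H x -> b \in Tset G alpha H x ->
    c \in Tset G alpha H x -> a * b ^+ 2 = c ^+ 3 -> a = c /\ b = c.
  move=> Ta /liftP[h [Hh Eb Th]] /liftP[k [Hk Ec Tk]] E.
  have Ea : a = coset 'C_H[x] ((k * h^-1) ^+ 3 * h).
    (* In H this is the representative k ^+ 3 * h ^- 2 of c ^+ 3 * b ^- 2. *)
    apply: (mulIg (coset 'C_H[x] h ^+ 2)); rewrite -{1}Eb E Ec -!morphX ?nCH //.
    rewrite -morphM ?nCH ?groupM ?groupX ?groupM ?groupV //=.
    congr (coset 'C_H[x] _); rewrite expgMn; last by apply/commuteV/cH.
    by rewrite expgVn -!mulgA -expgS mulVg mulg1.
  have Twh : (k * h^-1) ^+ 3 * (h * x) \in T3 G alpha.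
    rewrite mulgA; apply: TsetP; last by rewrite -Ea.
    by rewrite groupM ?groupX ?groupM ?groupV.
  have cb : c = b.
    rewrite Eb Ec; apply: coset_eq => //.
    apply: (commute_translates_cube alphaP) => //; last by rewrite mulgA mulgKV.
    by rewrite (subsetP sHT) ?groupM ?groupV.
  split=> //; apply: (mulIg (c ^+ 2)); rewrite {1}cb E; exact: expgS.
split.
- case=> a [b [c [Ta Tb Tc E]]]; apply.
  by have [-> ->] := progression_trivial a b c Ta Tb Tc E.
- case=> a [b [c [Ta Tb Tc E]]]; apply.
  by have [-> ->] := weighted_trivial a b c Ta Tb Tc E.
- case=> a [b [c [Ta Tb Tc E]]]; apply.
  by have [-> ->] := progression_trivial a b c Ta Tb Tc E.
Qed.
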